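(* Let $\lambda:[0,1]\to\mathbb{R}$ be a continuous function satisfying $$\lambda(1)=0,\qquad \lim_{r\to 1}\frac{\lambda(r)}{1-r}=\infty .$$ Then there exists a harmonic function $u(z)$ on the unit disc $\{z\in\mathbb{C}:|z|<1\}$ with $0\le u(z)\le 1$ such that, at every point $x\in\mathbb{T}$, $$\limsup_{r\to 1}u\bigl(re^{i(x+\lambda(r))}\bigr)=1,\qquad \liminf_{r\to 1}u\bigl(re^{i(x+\lambda(r))}\bigr)=0 .$$
   Context: $\mathbb{T}=\mathbb{R}/2\pi\mathbb{Z}$. Limits $r\to1$ are taken over $r<1$, and $\infty$ means $+\infty$. *)

(* Defs.v *)
From HB Require Import structures.
From mathcomp Require Import all_boot all_order all_algebra.
From mathcomp Require Import complex.
From mathcomp Require Import all_classical all_reals all_analysis.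

Set Implicit Arguments.
Unset Strict Implicit.
Unset Printing Implicit Defensive.

Import Order.TTheory GRing.Theory Num.Theory.
Import numFieldNormedType.Exports.

Local Open Scope classical_set_scope.
Local Open Scope ring_scope.
Local Open Scope complex_scope.

Section Plane.
Variable R : realType.
Implicit Types (f : R * R -> R) (D : set (R * R)).

Definition dx f : R * R -> R := 'D_((1, 0) : R * R) f.
Definition dy f : R * R -> R := 'D_((0, 1) : R * R) f.

(* Meant for open D, as the partial derivatives are two-sided. *)
Fixpoint Ck_on (k : nat) D f : Prop :=
  (forall p, D p -> {for p, continuous f}) /\
  (if k is k'.+1 then
     [/\ forall p, D p -> derivable f p ((1, 0) : R * R),
         forall p, D p -> derivable f p ((0, 1) : R * R),
         Ck_on k' D (dx f) & Ck_on k' D (dy f)]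
   else True).

Definition laplacian f (p : R * R) : R := dx (dx f) p + dy (dy f) p.

End Plane.

Section Complex.
Variable R : realType.

Definition unit_disc : set R[i] := [set z | `|z| < 1].

Definition expi (t : R) : R[i] := cos t +i* sin t.

(* u is read in the coordinates (Re z, Im z) because the library's directional
   derivatives need a normed space over R, and R[i] carries no such instance. *)
Definition harmonic_on (D : set R[i]) (u : R[i] -> R) : Prop :=
  let uxy := fun p : R * R => u (p.1 +i* p.2) in
  let Dxy := [set p : R * R | D (p.1 +i* p.2)] in
  Ck_on 2 Dxy uxy /\ forall p, Dxy p -> laplacian uxy p = 0.

End Complex.

Arguments unit_disc : clear implicits.

(* Main.v *)
(* On the circle, start from f = 0 and repeatedly replace f by
     f + G (2 N t) * ((1 + cos (N t)) / 2 - f),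
   where G is a Fejer kernel scaled to have maximum 1 and mean 1/l.  The new
   function still takes values in [0, 1]; it equals 1 where N t = 0 and 0 where
   N t = pi modulo 2 pi, and its Poisson extension differs from the old one by
   at most 1/l + |z|^(2 N).  As the extension of a trigonometric polynomial is
   Lipschitz in the radius with constant O(N), it is near its boundary values
   once 1 - r << 1/N; on the other hand x + lambda(r) runs through a full period
   2 pi / N once lambda(r) >> 1/N.  Both hold for 1/N comparable to lambda(r1)
   with r1 near 1, because lambda(r) / (1 - r) tends to infinity.  The errors
   being summable, the extensions converge and each later step destroys neither
   the near-maxima nor the near-minima produced by the previous ones. *)

Require Import Defs.
From HB Require Import structures.
From mathcomp Require Import all_boot all_order all_algebra.
From mathcomp Require Import complex zify ring lra.
From mathcomp Require Import all_classical all_reals all_analysis.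

Set Implicit Arguments.
Unset Strict Implicit.
Unset Printing Implicit Defensive.

Import Order.TTheory GRing.Theory Num.Theory.
Import numFieldNormedType.Exports.

Local Open Scope classical_set_scope.
Local Open Scope ring_scope.
Local Open Scope complex_scope.

Import ComplexField.Normc.
Local Notation Re := complex.Re.
Local Notation Im := complex.Im.

(** * Moduli, real parts and roots of unity *)

Section Modulus.
Variable R : realType.
Implicit Types (x t : R) (z w : R[i]) (k n : nat).

Lemma ReD z w : Re (z + w) = Re z + Re w.
Proof. by case: z w => [a b] [c d] /=. Qed.

Lemma ReB z w : Re (z - w) = Re z - Re w.
Proof. by case: z w => [a b] [c d] /=. Qed.

Lemma ReM z w : Re (z * w) = Re z * Re w - Im z * Im w.
Proof. by case: z w => [a b] [c d] /=. Qed.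

Lemma ReZ x z : Re (x%:C * z) = x * Re z.
Proof. by case: z => a b /=; rewrite mul0r subr0. Qed.

Lemma Re_sum (I : Type) (r : seq I) (P : pred I) (F : I -> R[i]) :
  Re (\sum_(i <- r | P i) F i) = \sum_(i <- r | P i) Re (F i).
Proof. exact: (big_morph (@Re R) ReD). Qed.

Lemma normc_ge0 z : 0 <= normc z.
Proof. by case: z => a b /=; rewrite sqrtr_ge0. Qed.

Lemma normc_sqr z : normc z ^+ 2 = Re z ^+ 2 + Im z ^+ 2.
Proof. by case: z => a b /=; rewrite sqr_sqrtr ?addr_ge0 ?sqr_ge0. Qed.

Lemma normcD_le z w : normc (z + w) <= normc z + normc w.
Proof. exact: le_normcD. Qed.

Lemma normcX z n : normc (z ^+ n) = normc z ^+ n.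
Proof. by elim: n => [|n IH]; rewrite ?expr0 ?normc1// !exprS normcM IH. Qed.

Lemma normc_real x : normc x%:C = `|x|.
Proof. by rewrite /= expr0n addr0 sqrtr_sqr. Qed.

Lemma Re_le_normc z : `|Re z| <= normc z.
Proof.
rewrite -[leLHS]ger0_norm// -[leRHS]ger0_norm ?normc_ge0// -ler_sqr ?nnegrE//.
by rewrite !real_normK ?num_real// normc_sqr lerDl sqr_ge0.
Qed.

Lemma normc_lt1E z : (`|z| < 1) = (normc z < 1).
Proof. by rewrite -[`|z|]/((normc z)%:C) -[1]/(1%:C) ltcR. Qed.

Lemma expiD t x : expi (t + x) = expi t * expi x.
Proof. by rewrite /expi cosD sinD [X in _ +i* X]addrC. Qed.

Lemma expiX t n : expi t ^+ n = expi (n%:R * t).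
Proof.
elim: n => [|n IH]; first by rewrite mul0r /expi cos0 sin0.
by rewrite exprS IH -expiD mulrSr mulrDl mul1r addrC.
Qed.

Lemma normc_expi t : normc (expi t) = 1.
Proof. by rewrite /= cos2Dsin2 sqrtr1. Qed.

Lemma expi_2pi n : expi (n%:R * (2 * pi)) = 1 :> R[i].
Proof.
rewrite -expiX /expi mulr_natl cos2pi sin2pi; exact: expr1n.
Qed.

Lemma expi_neq1 t : 0 < t < 2 * pi -> expi t != 1.
Proof.
move=> /andP[t0 t2]; apply/eqP => -[ct _].
have s0 : 0 < sin (t / 2) by apply: sin_gt0_pi; rewrite divr_gt0//=; lra.
have : cos (t / 2 + t / 2) = 1 by rewrite -splitr.
rewrite cosD; have := cos2Dsin2 (t / 2); move: s0; nra.
Qed.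

(** The angle [2 pi k / n] of [w ^+ k] lies strictly between 0 and [2 pi], so [w ^+ k] is not 1,
    while [w ^+ k - 1] times the geometric sum is [w ^+ (k n) - 1 = 0]. *)
Lemma root_unity_sum n k : (0 < k < n)%N ->
  \sum_(j < n) (expi (2 * pi / n%:R) ^+ j) ^+ k = 0 :> R[i].
Proof.
move=> /andP[k0 kn].
have n0 : (0 : R) < n%:R by rewrite ltr0n (leq_trans _ kn).
set w := expi _.
have wn : w ^+ n = 1.
  by rewrite expiX mulrC divfK ?gt_eqF// -[_ * pi]mul1r (expi_2pi 1).
have wk : w ^+ k != 1.
  rewrite expiX; apply: expi_neq1; rewrite mulr_gt0 ?ltr0n//=; last first.
    by rewrite divr_gt0// mulr_gt0// pi_gt0.
  rewrite mulrCA gtr_pMr ?ltr_pdivrMr ?mul1r ?ltr_nat//.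
  by rewrite mulr_gt0// pi_gt0.
have : (w ^+ k - 1) * (\sum_(j < n) (w ^+ j) ^+ k) = 0.
  under eq_bigr do rewrite exprAC.
  by rewrite -subrX1 exprAC wn expr1n subrr.
by move=> /eqP; rewrite mulf_eq0 subr_eq0 (negPf wk)/= => /eqP.
Qed.

End Modulus.

(** * Harmonic polynomials: discrete mean values and the maximum principle *)

Section HarmonicPolynomials.
Variable R : realType.
Implicit Types (z w : R[i]) (a : nat -> R) (d n : nat).

Definition hpoly d a z : R := \sum_(k < d) a k * Re (z ^+ k).

(** A mean value property without integrals: in the binomial expansion, the terms with the [i]-th
    power of the root of unity, [0 < i <= k < n], sum to zero over [j]. *)
Lemma root_unity_mean n k (z : R[i]) (r : R) : (k < n)%N ->
  \sum_(j < n) (z + r%:C * expi (2 * pi / n%:R) ^+ j) ^+ k = n%:R * z ^+ k.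
Proof.
move=> kn; under eq_bigr do rewrite exprDn.
rewrite exchange_big big_ord_recl/= [X in _ + X]big1 => [|i _].
  by under eq_bigr do rewrite subn0 expr0 mulr1 bin0;
    rewrite sumr_const card_ord addr0 mulr_natl.
under eq_bigr do rewrite exprMn mulrA -mulrnAl.
rewrite -mulr_sumr root_unity_sum ?mulr0//.
by rewrite /bump/= (leq_ltn_trans _ kn).
Qed.

Lemma hpoly_mean d a n z (r : R) : (d <= n)%N ->
  \sum_(j < n) hpoly d a (z + r%:C * expi (2 * pi / n%:R) ^+ j)
    = n%:R * hpoly d a z.
Proof.
move=> dn; rewrite exchange_big/= mulr_sumr; apply: eq_bigr => k _.
rewrite -mulr_sumr -Re_sum root_unity_mean ?(leq_trans (ltn_ord k))//.
by rewrite -(rmorph_nat (real_complex R)) ReZ mulrCA.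
Qed.

(** Expanding the square leaves a cross term linear in [w ^+ j], which sums to zero once there are
    at least two points. *)
Lemma normc_sqr_mean n z (r : R) : (1 < n)%N ->
  \sum_(j < n) normc (z + r%:C * expi (2 * pi / n%:R) ^+ j) ^+ 2
    = n%:R * (normc z ^+ 2 + r ^+ 2).
Proof.
move=> n1; set w := expi _.
have E (v : R[i]) : normc v = 1 -> normc (z + r%:C * v) ^+ 2 =
    normc z ^+ 2 + r ^+ 2 + 2 * r * Re (z^* * v).
  move=> v1; have := normc_sqr v; rewrite v1 !normc_sqr expr1n.
  case: z v {v1} => [x y] [s t] /= v1; 
  have -> : r ^+ 2 = r ^+ 2 * (s ^+ 2 + t ^+ 2) by rewrite -v1 mulr1.
  by ring.
under eq_bigr do rewrite E ?normcX ?normc_expi ?expr1n//.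
rewrite big_split/= sumr_const card_ord -mulr_sumr -Re_sum -mulr_sumr.
under eq_bigr do rewrite -[_ ^+ _]expr1.
by rewrite root_unity_sum// ReM/= !mulr0 subrr mulr0 addr0 mulr_natl.
Qed.

Lemma Re_expr_continuous k :
  continuous (fun p : R * R => Re ((p.1 +i* p.2) ^+ k)).
Proof.
(* Both parts go through the induction together, since each part of the next power involves both
   parts of the previous one. *)
suff H : continuous (fun p : R * R => Re ((p.1 +i* p.2) ^+ k)) /\
    continuous (fun p : R * R => Im ((p.1 +i* p.2) ^+ k)) by case: H.
elim: k => [|k [cR cI]]; first by split => p; apply: cvg_cst.
pose A p : R[i] := (p.1 +i* p.2) ^+ k.
have -> : (fun p : R * R => Re ((p.1 +i* p.2) ^+ k.+1)) =
    (fun p => p.1 * Re (A p) - p.2 * Im (A p)).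
  by apply/funext => p; rewrite exprS ReM.
have -> : (fun p : R * R => Im ((p.1 +i* p.2) ^+ k.+1)) =
    (fun p => p.1 * Im (A p) + p.2 * Re (A p)).
  by apply/funext => p; rewrite exprS /A; case: (_ ^+ k).
by split => p; [apply: cvgB | apply: cvgD];
  apply: cvgM; (exact: cvg_fst || exact: cvg_snd || exact: cR || exact: cI).
Qed.

Lemma hpoly_continuous d a :
  continuous (fun p : R * R => hpoly d a (p.1 +i* p.2)).
Proof.
elim: d => [|d IH].
  have -> : (fun p : R * R => hpoly 0 a (p.1 +i* p.2)) = cst 0.
    by apply/funext => p; rewrite /hpoly big_ord0.
  by move=> p; exact: cvg_cst.
have -> : (fun p : R * R => hpoly d.+1 a (p.1 +i* p.2)) = (fun p =>
    hpoly d a (p.1 +i* p.2) + a d * Re ((p.1 +i* p.2) ^+ d)).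
  by apply/funext => p; rewrite /hpoly big_ord_recr.
move=> p.
apply: cvgD; first exact: IH.
by apply: cvgM; [exact: cvg_cst | exact: Re_expr_continuous].
Qed.

Lemma normc_sqr_continuous :
  continuous (fun p : R * R => normc (p.1 +i* p.2) ^+ 2).
Proof.
have -> : (fun p : R * R => normc (p.1 +i* p.2) ^+ 2) =
    (fun p => p.1 ^+ 2 + p.2 ^+ 2) by apply/funext => p; rewrite normc_sqr.
by move=> p; apply: cvgD; apply: cvgM; (exact: cvg_fst || exact: cvg_snd).
Qed.

Lemma compact_closed_disc : compact [set p : R * R | normc (p.1 +i* p.2) <= 1].
Proof.
apply: (@subclosed_compact _ _ (`[- 1 : R, 1%R] `*` `[- 1 : R, 1%R])).
- have -> : [set p : R * R | normc (p.1 +i* p.2) <= 1] =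
      (fun p => normc (p.1 +i* p.2) ^+ 2) @^-1` [set x | x <= 1].
    by apply/seteqP; split => p /=; rewrite expr_le1// sqrtr_ge0.
  apply: (continuous_closedP _).1; last exact: closed_le.
  exact: normc_sqr_continuous.
- by apply: compact_setX; exact: segment_compact.
- move=> [x y]; rewrite /= -(expr_le1 (n := 2)) ?sqrtr_ge0//.
  by rewrite sqr_sqrtr ?addr_ge0 ?sqr_ge0// => h; rewrite !in_itv/=; split; nra.
Qed.

(* Maximum principle: at an interior minimum c of u - e |z|^2 on the closed
   disc, the mean value property over roots of unity centred at c contradicts
   minimality because the mean of |z|^2 exceeds |c|^2. *)
Lemma hpoly_ge0 d a : (forall w, normc w = 1 -> 0 <= hpoly d a w) ->
  forall z, normc z <= 1 -> 0 <= hpoly d a z.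
Proof.
move=> circ z z1; apply/ler_addgt0Pr => e e0.
pose F w := hpoly d a w - e * normc w ^+ 2.
have [c cD cmin] : exists2 c, normc c <= 1 &
    forall w, normc w <= 1 -> F c <= F w.
  have [|p|c] := @compact_EVT_min _ _ (fun p : R * R => F (p.1 +i* p.2)) _ _
    compact_closed_disc.
  - by exists (0, 0) => /=; rewrite expr0n addr0 sqrtr0.
  - apply: continuous_subspaceT => {}p; apply: cvgB.
      exact: hpoly_continuous.
    apply: cvgM; first exact: cvg_cst.
    exact: normc_sqr_continuous.
  rewrite inE => cD cmin; exists (c.1 +i* c.2) => // w w1.
  have := cmin (Re w, Im w); rewrite inE/=.
  by case: w w1 => s t /= w1 /(_ w1).
suff : - e <= F c.
  move=> /le_trans/(_ (cmin _ z1)); rewrite /F lerBrDr addrC -subr_ge0.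
  have := mulr_ge0 (ltW e0) (sqr_ge0 (normc z)); lra.
have [c1|c1] := eqVneq (normc c) 1.
  by rewrite /F c1 expr1n mulr1 lerDr circ.
have {cD}c1' : normc c < 1 by rewrite lt_neqAle c1.
(* [d.+2] points serve both means: at least [d] for the polynomial and at least 2 for [|z|^2]. The
   radius [1 - normc c] keeps the points in the closed disc. *)
have /= := hpoly_mean a c (1 - normc c) (leqW (leqnSn d)).
have := normc_sqr_mean c (1 - normc c) (isT : (1 < d.+2)%N).
move=> sq me.
pose w (j : 'I_d.+2) := c + (1 - normc c)%:C * expi (2 * pi / d.+2%:R) ^+ j.
have : \sum_(j < d.+2) F c <= \sum_(j < d.+2) F (w j).
  apply: ler_sum => j _; apply: cmin.
  rewrite /w (le_trans (normcD_le _ _))// normcM normcX normc_expi expr1n mulr1.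
  by rewrite normc_real ger0_norm ?subr_ge0 ?(ltW c1')// addrC subrK.
rewrite sumr_const card_ord sumrB -mulr_sumr me sq -mulr_natl {1}/F.
have : 0 < d.+2%:R * (e * (1 - normc c) ^+ 2).
  by rewrite !mulr_gt0// ?exprn_gt0 ?subr_gt0.
lra.
Qed.

End HarmonicPolynomials.

(** * Cosine polynomials with control of degree and coefficients *)

Section BoundedHarmonicPolynomials.
Variable R : realType.
Implicit Types (z w : R[i]) (d e n : nat) (A B c r : R) (u v : R[i] -> R).

(* u is the harmonic extension of a cosine polynomial with frequencies below d
   and coefficients of l^1-norm at most A. *)
Definition hbound d A u :=
  exists2 a, u =1 hpoly d a & \sum_(k < d) `|a k| <= A.

Lemma hbound_weaken d e A B u :
  (d <= e)%N -> A <= B -> hbound d A u -> hbound e B u.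
Proof.
move=> de AB [a ua aA]; exists (fun k => if (k < d)%N then a k else 0).
  move=> z; rewrite ua /hpoly (big_ord_widen _ (fun k => a k * Re (z ^+ k)) de).
  by rewrite big_mkcond; apply: eq_bigr => i _; case: ifP; rewrite ?mul0r.
rewrite (le_trans _ AB)// (le_trans _ aA)//.
rewrite (big_ord_widen _ (fun k => `|a k|) de) [leRHS]big_mkcond.
by apply: ler_sum => i _; case: ifP; rewrite ?normr0.
Qed.

Lemma hboundD d A B u v :
  hbound d A u -> hbound d B v -> hbound d (A + B) (fun z => u z + v z).
Proof.
move=> [a ua aA] [b vb bB]; exists (fun k => a k + b k).
  move=> z; rewrite ua vb -big_split/=; apply: eq_bigr => i _.
  by rewrite mulrDl.
rewrite (le_trans _ (lerD aA bB))// -big_split/=.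
by apply: ler_sum => i _; rewrite ler_normD.
Qed.

Lemma hboundZ d A c u : hbound d A u -> hbound d (`|c| * A) (fun z => c * u z).
Proof.
move=> [a ua aA]; exists (fun k => c * a k).
  by move=> z; rewrite ua mulr_sumr; apply: eq_bigr => i _; rewrite mulrA.
rewrite (le_trans _ (ler_wpM2l _ aA))// mulr_sumr.
by apply: ler_sum => i _; rewrite normrM.
Qed.

Lemma hbound_exp n : hbound n.+1 1 (fun z => Re (z ^+ n)).
Proof.
exists (fun k => (k == n)%:R) => [z|]; rewrite /hpoly big_ord_recr/= big1 ?eqxx.
- by rewrite add0r mul1r.
- by move=> i _; rewrite ltn_eqF ?mul0r.
- by rewrite add0r normr1.
- by move=> i _; rewrite ltn_eqF ?normr0.
Qed.

Lemma hbound_sum (I : Type) (s : seq I) (P : pred I) d (A : I -> R)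
    (u : I -> R[i] -> R) :
  (forall i, P i -> hbound d (A i) (u i)) ->
  hbound d (\sum_(i <- s | P i) A i) (fun z => \sum_(i <- s | P i) u i z).
Proof.
move=> H; elim: s => [|i s IH].
  exists (fun=> 0) => [z|]; rewrite ?big_nil; last by rewrite big1// normr0.
  by rewrite /hpoly big1// => i _; rewrite mul0r.
under [X in hbound _ _ X]eq_fun do rewrite big_cons.
by rewrite big_cons; case: ifP => // Pi; apply: hboundD => //; exact: H.
Qed.

(** The formula for [cos (i t) cos (j t)]; with truncated subtraction, [i - j + (j - i)] is the
    distance between [i] and [j]. *)
Lemma Re_expM_circle w i j : normc w = 1 -> Re (w ^+ i) * Re (w ^+ j) =
  2^-1 * (Re (w ^+ (i + j)) + Re (w ^+ (i - j + (j - i)))).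
Proof.
move=> w1; wlog ji : i j / (j <= i)%N => [H|].
  case/orP: (leq_total j i) => /H//.
  by rewrite mulrC [(j + i)%N]addnC [(j - i + _)%N]addnC.
have /eqP -> : (j - i == 0)%N by rewrite subn_eq0.
rewrite addn0 -{1 2}(subnK ji) -addnA !exprD.
have := normc_sqr (w ^+ j); rewrite normcX w1 !expr1n.
case: (w ^+ j) (w ^+ (i - j)) => [x y] [s t] /= xy.
have sE : s = s * (x ^+ 2 + y ^+ 2) by rewrite -xy mulr1.
by rewrite [X in _ = _ * (_ + X)]sE; field.
Qed.

(** A product of harmonic functions need not be harmonic, so [p] extends the product of the boundary
    values, linearized by [Re_expM_circle]. Each pair of coefficients yields two halves, hence the
    l^1 bounds multiply. *)
Lemma hbound_mul_circle d e A B u v : hbound d A u -> hbound e B v ->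
  exists2 p, hbound (d + e) (A * B) p &
    forall w, normc w = 1 -> p w = u w * v w.
Proof.
move=> [a ua aA] [b vb bB].
exists (fun z => \sum_(i < d) \sum_(j < e) (a i * b j * 2^-1) *
    (Re (z ^+ (i + j)) + Re (z ^+ (i - j + (j - i))))); last first.
  move=> w w1; rewrite ua vb mulr_suml; apply: eq_bigr => i _.
  rewrite mulr_sumr; apply: eq_bigr => j _.
  by rewrite mulrACA Re_expM_circle// mulrA.
apply: (@hbound_weaken (d + e) _ (\sum_(i < d) \sum_(j < e)
    `|a i * b j * 2^-1| * 2)) => //.
  rewrite (@le_trans _ _ ((\sum_(i < d) `|a i|) * (\sum_(j < e) `|b j|)))//.
    rewrite mulr_suml; apply: ler_sum => i _.
    rewrite mulr_sumr; apply: ler_sum => j _.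
    by rewrite !normrM [`|2^-1|]ger0_norm// mulfVK.
  by apply: ler_pM => //; apply: sumr_ge0.
apply: hbound_sum => i _; apply: hbound_sum => j _.
have [? ?] := (ltn_ord i, ltn_ord j).
by apply/hboundZ/hboundD; apply: hbound_weaken (hbound_exp _) => //; lia.
Qed.

(** Frequency [k] contributes at most [1 - r ^+ k], which is [1 - r] times a sum of [k] powers of
    [r], each at most 1. *)
Lemma hbound_lipschitz d A u r w : hbound d A u -> 0 <= r <= 1 -> normc w = 1 ->
  `|u (r%:C * w) - u w| <= (1 - r) * d%:R * A.
Proof.
move=> [a ua aA] /andP[r0 r1] w1.
rewrite !ua -sumrB (le_trans (ler_norm_sum _ _ _))//.
rewrite (le_trans _ (ler_wpM2l _ aA)) ?mulr_ge0 ?subr_ge0// mulr_sumr.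
apply: ler_sum => k _; rewrite -mulrBr normrM mulrC ler_wpM2r//.
rewrite exprMn -rmorphXn ReZ/= -{2}[Re _]mul1r -mulrBl normrM.
rewrite (@le_trans _ _ (`|r ^+ k - 1| * 1))//.
  by rewrite ler_wpM2l// (le_trans (Re_le_normc _))// normcX w1 expr1n.
have rk1 : r ^+ k <= 1 by rewrite exprn_ile1.
rewrite mulr1 distrC ger0_norm ?subr_ge0// -[leLHS]opprK opprB subrX1 -mulNr
  opprB.
rewrite ler_wpM2l ?subr_ge0//.
rewrite (@le_trans _ _ (\sum_(i < k) 1))//.
  by apply: ler_sum => i _; rewrite exprn_ile1.
by rewrite sumr_const card_ord ler_nat ltnW.
Qed.

Lemma hbound_ge0 d A u : hbound d A u ->
  (forall w, normc w = 1 -> 0 <= u w) -> forall z, normc z <= 1 -> 0 <= u z.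
Proof.
move=> [a ua _] u0 z z1; rewrite ua; apply: hpoly_ge0 z1 => w w1.
by rewrite -ua u0.
Qed.

Lemma root_unity_Re_sum n k : (0 < n)%N -> (k < n)%N ->
  \sum_(j < n) Re ((expi (2 * pi / n%:R) ^+ j) ^+ k) =
  (n * (k == 0))%:R :> R.
Proof.
move=> n0 kn; rewrite -Re_sum; have [->|k0] := posnP k.
  by rewrite sumr_const card_ord -(rmorph_nat (real_complex R)) muln1.
by rewrite root_unity_sum ?k0// muln0.
Qed.

(** A discrete Fourier coefficient: testing against [Re (x ^+ k)] over [2 d] roots of unity isolates
    [a k], as [i + k < 2 d] excludes aliasing. The factor 2 is the inverse of the mean of [cos^2]
    when [k > 0]. *)
Lemma hpoly_coef_le d (a : nat -> R) (rho eps : R) k : (k < d)%N -> 0 <= rho ->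
  (forall z, normc z = rho -> `|hpoly d a z| <= eps) ->
  `|a k| * rho ^+ k <= 2 * eps.
Proof.
move=> kd rho0 H; pose n := (d + d)%N; have n0 : (0 < n)%N by rewrite /n; lia.
pose x (j : 'I_n) : R[i] := expi (2 * pi / n%:R) ^+ j.
have x1 j : normc (x j) = 1 by rewrite normcX normc_expi expr1n.
have : \sum_(j < n) hpoly d a (rho%:C * x j) * Re (x j ^+ k) =
    2^-1 * n%:R * (1 + (k == 0)%:R) * (a k * rho ^+ k).
  under eq_bigr do rewrite mulr_suml.
  rewrite exchange_big/= (bigD1 (Ordinal kd))//= [X in _ + X]big1 => [|i ik].
    rewrite addr0; under eq_bigr => j _.
      rewrite exprMn -rmorphXn ReZ/= mulrA -mulrA Re_expM_circle// subnn addn0.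
      rewrite expr0; over.
    rewrite -mulr_sumr -mulr_sumr big_split/= sumr_const card_ord.
    rewrite root_unity_Re_sum ?addn_eq0 ?andbb//; last by rewrite /n; lia.
    by rewrite natrM; field.
  under eq_bigr => j _.
    rewrite exprMn -rmorphXn ReZ/= mulrA -mulrA Re_expM_circle//; over.
  have di := ltn_ord i; move: ik; rewrite -val_eqE/= => ik.
  rewrite -mulr_sumr -mulr_sumr big_split/= !root_unity_Re_sum//.
  - have [-> ->] : (i + k == 0)%N = false /\ (i - k + (k - i) == 0)%N = false by
      lia.
    by rewrite muln0 addr0 !mulr0.
  - by rewrite /n; lia.
  - by rewrite /n; lia.
move=> E; have : `|2^-1 * n%:R * (1 + (k == 0)%:R) * (a k * rho ^+ k)| <= n%:R *
  eps.
  rewrite -E (le_trans (ler_norm_sum _ _ _))//.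
  rewrite (@le_trans _ _ (\sum_(j < n) eps))//; last first.
    by rewrite sumr_const card_ord mulr_natl.
  apply: ler_sum => j _; rewrite normrM -[leRHS]mulr1 ler_pM//.
    by apply: H; rewrite normcM x1 normc_real mulr1 ger0_norm.
  by rewrite (le_trans (Re_le_normc _))// normcX x1 expr1n.
have nR : (0 : R) < n%:R by rewrite ltr0n.
rewrite !normrM (ger0_norm (exprn_ge0 k rho0)) normr_nat [`|2^-1|]ger0_norm//.
rewrite [`|1 + _|]ger0_norm// [2^-1 * _]mulrC -!mulrA ler_pM2l//.
have : 0 <= `|a k| * rho ^+ k by rewrite mulr_ge0 ?exprn_ge0.
by case: (k == 0)%N => /=; lra.
Qed.

End BoundedHarmonicPolynomials.

(** * Fejer kernels and the insertion of peaks *)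

Section Fejer.
Variable R : realType.
Implicit Types (z w : R[i]) (l N d : nat) (A rho : R) (u : R[i] -> R).

(* Fejer kernel at N t, scaled to have peak value 1 and mean 1/l. *)
Definition fejer l N z : R :=
  (l%:R ^+ 2)^-1 * \sum_(i < l) \sum_(j < l) Re (z ^+ (N * (i - j + (j - i)))).

Lemma hbound_fejer l N : (0 < l)%N -> hbound (N * l).+1 1 (fejer l N).
Proof.
move=> l0; have lR : (0 : R) < l%:R ^+ 2 by rewrite exprn_gt0// ltr0n.
apply: (@hbound_weaken _ _ _ (`|(l%:R ^+ 2)^-1| * \sum_(i < l) \sum_(j < l) 1)).
- exact: leqnn.
- rewrite ger0_norm ?invr_ge0 ?(ltW lR)//.
  under eq_bigr do rewrite sumr_const card_ord.
  by rewrite sumr_const card_ord -mulrnA natrM -expr2 mulVf ?(gt_eqF lR)//.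
- apply: hboundZ; apply: hbound_sum => i _; apply: hbound_sum => j _.
  apply: hbound_weaken (hbound_exp _ _) => //.
  by have [? ?] := (ltn_ord i, ltn_ord j); rewrite ltnS leq_mul2l; lia.
Qed.

(** This is the real part of [w ^+ i] times the conjugate of [w ^+ j]. It turns the double sum in
    [fejer] into the squared modulus of a single sum, hence positivity on the circle. *)
Lemma Re_conj_circle w i j : normc w = 1 ->
  Re (w ^+ (i - j + (j - i))) =
  Re (w ^+ i) * Re (w ^+ j) + Im (w ^+ i) * Im (w ^+ j).
Proof.
move=> w1; wlog ji : i j / (j <= i)%N => [H|].
  case/orP: (leq_total j i) => /H//.
  by rewrite addnC mulrC [Im _ * _]mulrC.
have /eqP -> : (j - i == 0)%N by rewrite subn_eq0.
rewrite addn0 -{2 3}(subnK ji) !exprD.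
have := normc_sqr (w ^+ j); rewrite normcX w1 !expr1n.
case: (w ^+ j) (w ^+ (i - j)) => [x y] [s t] /= xy.
by rewrite -[LHS]mulr1 xy; ring.
Qed.

Lemma fejer_circle l N w : (0 < l)%N -> normc w = 1 -> 0 <= fejer l N w <= 1.
Proof.
move=> l0 w1; have lR : (0 : R) < l%:R ^+ 2 by rewrite exprn_gt0// ltr0n.
have wN : normc (w ^+ N) = 1 by rewrite normcX w1 expr1n.
apply/andP; split.
  rewrite mulr_ge0 ?invr_ge0 ?(ltW lR)//.
  under eq_bigr do under eq_bigr do rewrite exprM Re_conj_circle//.
  under eq_bigr do rewrite big_split/= -!mulr_sumr.
  by rewrite big_split/= -!mulr_suml addr_ge0// -expr2 sqr_ge0.
rewrite ler_pdivrMl// mulr1.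
rewrite (@le_trans _ _ (\sum_(i < l) \sum_(j < l) 1))//.
  apply: ler_sum => i _; apply: ler_sum => j _.
  by rewrite (le_trans (ler_norm _))// (le_trans (Re_le_normc _))// normcX w1
    expr1n.
under eq_bigr do rewrite sumr_const card_ord.
by rewrite sumr_const card_ord -mulrnA natrM.
Qed.

Lemma fejer_eq1 l N w : (0 < l)%N -> w ^+ N = 1 -> fejer l N w = 1.
Proof.
move=> l0 wN; rewrite /fejer.
under eq_bigr do under eq_bigr do rewrite exprM wN expr1n.
under eq_bigr do rewrite sumr_const card_ord.
by rewrite sumr_const card_ord -mulrnA natrM -expr2 mulVf ?gt_eqF// exprn_gt0//
  ltr0n.
Qed.

(** The [l] diagonal terms, out of [l ^ 2], give [1 / l]; every other term has frequency at least
    [N] and is at most [rho ^+ N]. *)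
Lemma fejer_disc l N z rho : (0 < l)%N -> rho <= 1 -> normc z <= rho ->
  fejer l N z <= l%:R^-1 + rho ^+ N.
Proof.
move=> l0 rho1 zr; have lR : (0 : R) < l%:R by rewrite ltr0n.
have rho0 : 0 <= rho by rewrite (le_trans (normc_ge0 z)).
rewrite ler_pdivrMl ?exprn_gt0//.
rewrite (@le_trans _ _ (\sum_(i < l) \sum_(j < l) ((i == j)%:R + rho ^+ N)))//.
  apply: ler_sum => i _; apply: ler_sum => j _.
  rewrite (le_trans (ler_norm _))// (le_trans (Re_le_normc _))// normcX.
  have [->|ij] := eqVneq i j.
    by rewrite subnn muln0 expr0 lerDl exprn_ge0.
  rewrite add0r (@le_trans _ _ (rho ^+ (N * (i - j + (j - i)))))//.
    by rewrite lerXn2r// nnegrE ?normc_ge0.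
  rewrite ler_wiXn2l// leq_pmulr//; move: ij; rewrite -val_eqE/=; lia.
under eq_bigr => i _.
  rewrite big_split/= sumr_const card_ord (bigD1 i)//= eqxx big1 ?addr0; last
    first.
    by move=> j; rewrite eq_sym => /negPf ->.
  over.
rewrite sumr_const card_ord -[leLHS]mulr_natl -mulr_natl mulrDr mulr1 mulrDr.
by rewrite expr2 mulfK ?gt_eqF// mulr1 -[rho ^+ N *+ l]mulr_natl mulrA.
Qed.

(** The kernel runs at frequency [2 N], so that it peaks both where [w ^+ N = 1] and where
    [w ^+ N = -1]. On the circle the correction [p] lies between minus the kernel and the kernel;
    the maximum principle carries this into the disc, where [fejer_disc] applies. *)
Lemma hbound_add_peaks d A u l N :
  (0 < l)%N -> hbound d A u ->
  (forall w, normc w = 1 -> 0 <= u w <= 1) ->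
  exists u' : R[i] -> R,
  [/\ hbound ((2 * N * l).+1 + (d + N.+1)) (A + 1 * (1 + A)) u',
      forall w, normc w = 1 -> 0 <= u' w <= 1,
      forall w, normc w = 1 -> w ^+ N = 1 -> u' w = 1,
      forall w, normc w = 1 -> w ^+ N = -1 -> u' w = 0 &
      forall z rho, rho <= 1 -> normc z <= rho ->
        `|u' z - u z| <= l%:R^-1 + rho ^+ (2 * N)].
Proof.
move=> l0 hu u01.
have hv : hbound (d + N.+1) (`|2^-1| * 1 + `|2^-1| * 1 + `|-1| * A) (fun z =>
    2^-1 * Re (z ^+ 0) + 2^-1 * Re (z ^+ N) + -1 * u z).
  apply: hboundD; first apply: hboundD.
  - by apply: hboundZ; apply: hbound_weaken (hbound_exp _ _) => //; lia.
  - by apply: hboundZ; apply: hbound_weaken (hbound_exp _ _) => //; lia.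
  - by apply: hboundZ; apply: hbound_weaken hu => //; lia.
have {hv} : hbound (d + N.+1) (1 + A) (fun z =>
    2^-1 * Re (z ^+ 0) + 2^-1 * Re (z ^+ N) + -1 * u z).
  apply: hbound_weaken hv => //.
  by rewrite !mulr1 normrN1 mul1r [`|2^-1|]ger0_norm// lerD2r; lra.
have hf := hbound_fejer (2 * N) l0.
move=> /(hbound_mul_circle hf)[p hp pE].
have {}pE w : normc w = 1 -> p w = fejer l (2 * N) w * ((1 + Re (w ^+ N)) / 2 -
  u w).
  by move=> w1; rewrite pE// expr0; congr (_ * _) => /=; ring.
have ReN w : normc w = 1 -> -1 <= Re (w ^+ N) <= 1.
  by move=> w1; rewrite -ler_norml (le_trans (Re_le_normc _))// normcX w1
    expr1n.
(* The nonlinear facts needed below, as products of nonnegative factors; given these, the remaining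
   inequalities are linear in the monomials. *)
have prods w : normc w = 1 -> let a := u w in let b := Re (w ^+ N) in
    let c := fejer l (2 * N) w in
    [/\ 0 <= a * (1 - c), 0 <= (1 - a) * (1 - c), 0 <= a * c, 0 <= (1 - a) * c &
        0 <= (1 + b) * c /\ 0 <= (1 - b) * c].
  move=> w1 a b c; have /andP[? ?] : 0 <= a <= 1 := u01 _ w1.
  have /andP[? ?] : -1 <= b <= 1 := ReN _ w1.
  have /andP[? ?] : 0 <= c <= 1 := fejer_circle (2 * N) l0 w1.
  by split; try split; apply: mulr_ge0; lra.
exists (fun z => u z + p z); split.
- by apply: hboundD hp; apply: hbound_weaken hu => //; lia.
- move=> w w1; rewrite pE//.
  by have [? ? ? ? [? ?]] := prods _ w1; apply/andP; split; lra.
- move=> w w1 wN; rewrite pE// fejer_eq1 ?wN//=; last by rewrite mulnC exprM wN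
    expr1n.
  by field.
- move=> w w1 wN; rewrite pE// fejer_eq1 ?wN//=; last by rewrite mulnC exprM wN
    sqrrN expr1n.
  by field.
move=> z rho rho1 zr; rewrite addrAC subrr add0r.
have z1 : normc z <= 1 by rewrite (le_trans zr).
rewrite (@le_trans _ _ (fejer l (2 * N) z))//; last exact: fejer_disc.
pose D := ((2 * N * l).+1 + (d + N.+1))%N.
have hf' : hbound D 1 (fejer l (2 * N)) by apply: hbound_weaken hf => //; lia.
rewrite ler_norml; apply/andP; split; rewrite -subr_ge0.
  rewrite opprK; apply: (hbound_ge0 (hboundD hp hf')) z1 => w w1.
  rewrite pE//.
  by have [? ? ? ? [? ?]] := prods _ w1; lra.
rewrite -mulN1r; apply: (hbound_ge0 (hboundD hf' (hboundZ (-1) hp))) z1 => w w1.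
rewrite pE//.
by have [? ? ? ? [? ?]] := prods _ w1; lra.
Qed.

End Fejer.

(** * One step of the construction along the curves [x + lambda r] *)

Section TangentialStep.
Variables (R : realType) (lambda : R -> R).
Hypothesis lambda_cont : {within `[0, 1], continuous lambda}.
Hypothesis lambda1 : lambda 1 = 0.
Hypothesis lambda_lim : lambda r / (1 - r) @[r --> 1^'-] --> +oo.
Implicit Types (z w : R[i]) (d : nat) (A rho r x s eps : R) (u : R[i] -> R).

Lemma expi_2pi_int (m : int) : expi (m%:~R * (2 * pi)) = 1 :> R[i].
Proof.
case: m => n; first exact: expi_2pi.
rewrite -[LHS]mulr1 -[X in _ * X](expi_2pi R n.+1) -expiD NegzE mulrNz mulNr.
by rewrite addNr /expi cos0 sin0.
Qed.

(** The values [v] with [N (x + v)] congruent to [s] modulo [2 pi] are spaced by [2 pi / N], so one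
    lies between [lambda r2] and [lambda r1]; the intermediate value theorem then attains it. *)
Lemma phase_hit N (r1 r2 : R) x s : (0 < N)%N -> 0 <= r1 <= r2 -> r2 <= 1 ->
  2 * pi / N%:R <= lambda r1 - lambda r2 ->
  exists2 r, r1 <= r <= r2 & expi (x + lambda r) ^+ N = expi s.
Proof.
move=> N0 /andP[r10 r12] r21 gap.
have NR : (0 : R) < N%:R by rewrite ltr0n.
have p0 : (0 : R) < 2 * pi by rewrite mulr_gt0// pi_gt0.
(* The floor makes [v] the largest such value not exceeding [lambda r1]. *)
pose m := Num.floor ((N%:R * (x + lambda r1) - s) / (2 * pi)).
pose v := (m%:~R * (2 * pi) + s) / N%:R - x.
have v1 : v <= lambda r1.
  rewrite lerBlDl ler_pdivrMr// -lerBrDr [_ * N%:R]mulrC -ler_pdivlMr//.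
  exact: floor_le.
have v2 : lambda r2 <= v.
  have : (N%:R * (x + lambda r1) - s) / (2 * pi) < m%:~R + 1.
    by rewrite -[1]/(1%:~R) -intrD floorD1_gt.
  rewrite ltr_pdivrMr// => h.
  have qN : 2 * pi / N%:R * N%:R = 2 * pi :> R by rewrite divfK ?gt_eqF.
  rewrite lerBrDr ler_pdivlMr//.
  have : (2 * pi / N%:R) * N%:R <= (lambda r1 - lambda r2) * N%:R.
    by rewrite ler_wpM2r// ltW.
  by rewrite qN; move: h; lra.
have sub : {within `[r1, r2], continuous lambda}.
  apply: continuous_subspaceW lambda_cont => y /=; rewrite !in_itv/= => /andP[?
    ?].
  by apply/andP; split; lra.
have [|r] := @IVT _ _ r1 r2 v r12 sub.
  by rewrite ge_min le_max v1 v2 orbT.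
rewrite in_itv/= => rr lr; exists r => //.
rewrite lr expiX /v addrCA subrr addr0 [_ * (_ / _)]mulrC divfK ?gt_eqF//.
by rewrite expiD expi_2pi_int mul1r.
Qed.

Lemma lambda_cvg0 : lambda r @[r --> 1^'-] --> (0 : R).
Proof.
by rewrite -lambda1; have /(continuous_within_itvP _ ltr01)[] := lambda_cont.
Qed.

Lemma tangential_step d A u rho eps : hbound d A u ->
  (forall w, normc w = 1 -> 0 <= u w <= 1) ->
  0 <= rho < 1 -> 0 < eps ->
  exists u' : R[i] -> R, exists rho',
  [/\ exists d', exists A', hbound d' A' u',
      forall w, normc w = 1 -> 0 <= u' w <= 1,
      [/\ rho <= rho', rho' < 1 & 1 - eps <= rho'],
      forall z, normc z <= rho -> `|u' z - u z| <= eps &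
      forall x,
        (exists2 r, rho <= r <= rho' & 1 - eps <= u' (r%:C * expi (x + lambda
          r))) /\
        (exists2 r, rho <= r <= rho' & u' (r%:C * expi (x + lambda r)) <= eps)].
Proof.
move=> hu u01 /andP[rho0 rho1] e0.
have e20 : 0 < eps / 2 by rewrite divr_gt0.
have A0 : 0 <= A by case: hu => a _; apply: le_trans; apply: sumr_ge0.
have p0 : (0 : R) < pi := pi_gt0 R.
have [l l0 le] : exists2 l, (0 < l)%N & l%:R^-1 <= eps / 2.
  have [n /= _ H] := near_infty_natSinv_lt (PosNum e20).
  by exists n.+1 => //; apply: ltW; exact: (H n (leqnn _)).
have [n0 n0P] : exists n0, forall n, (n0 <= n)%N -> rho ^+ n <= eps / 2.
  have rn : `|rho| < 1 by rewrite ger0_norm.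
  have [n0 _ H] := cvgr_le (0 : R) (cvg_expr rn) _ e20.
  by exists n0 => n /H.
pose A' := A + 1 * (1 + A).
(* K1 and K2 make the radial Lipschitz error of u' at r1, of size
   (1 - r1) * O(1 / lambda r1 + 1), at most eps. *)
pose K1 := A' * (2 * l%:R + 1) * (4 * pi) + 1.
pose K2 := A' * (2 * l%:R + 3 + d%:R) + 1.
have A'0 : 0 <= A' by rewrite /A'; lra.
have K10 : 0 < K1 by rewrite ltr_pwDr// !mulr_ge0//; lra.
have K20 : 0 < K2 by rewrite ltr_pwDr// mulr_ge0// !addr_ge0 ?mulr_ge0.
(* All conditions hold for [r1] close enough to 1. The last one forces [n0 <= N] for the [N] chosen
   below, so that [rho ^+ (2 * N)] is at most [eps / 2]. *)
have [r1 [r1rho r1e r11 r1l [r1K r1n]]] : exists r1, [/\ rho <= r1,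
    1 - eps <= r1, r1 < 1, 2 * K1 / eps <= lambda r1 / (1 - r1)
    & 1 - r1 <= eps / (2 * K2) /\ lambda r1 <= 4 * pi / n0.+1%:R].
  have a1 : 1 - eps < 1 by lra.
  have a2 : 1 - eps / (2 * K2) < 1 by rewrite gtrBl divr_gt0// mulr_gt0.
  have a3 : 0 < 4 * pi / n0.+1%:R :> R by rewrite divr_gt0// mulr_gt0.
  near (at_left (1 : R)) => r1; exists r1; split.
  - by near: r1; apply: nbhs_left_ge.
  - by near: r1; apply: nbhs_left_ge.
  - by near: r1; apply: nbhs_left_lt.
  - by near: r1; move/cvgryPge : lambda_lim; apply.
  - split; first by rewrite lerBlDr -lerBlDl; near: r1; apply: nbhs_left_ge.
    by near: r1; apply: (cvgr_le _ lambda_cvg0).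
have s0 : 0 < 1 - r1 by rewrite subr_gt0.
have l10 : 0 < lambda r1.
  rewrite -(pmulr_lgt0 (lambda r1) (x := (1 - r1)^-1)) ?invr_gt0//.
  by rewrite (lt_le_trans _ r1l)// divr_gt0// mulr_gt0.
(* Between [r1] and [r2] the function [lambda] loses at least half of [lambda r1], which will exceed
   a full period [2 pi / N]. *)
have [r2 [r12 r21 l2]] : exists r2, [/\ r1 <= r2, r2 < 1 & lambda r2 <= lambda
  r1 / 2].
  have a1 : 0 < lambda r1 / 2 by rewrite divr_gt0.
  near (at_left (1 : R)) => r2; exists r2; split.
  - by near: r2; apply: nbhs_left_ge.
  - by near: r2; apply: nbhs_left_lt.
  - by near: r2; apply: (cvgr_le _ lambda_cvg0).
(* The least natural number above [4 pi / lambda r1]: large enough for the period to fit in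
   [lambda r1 / 2], small enough for the degree of [u'] to be [O(1 / lambda r1 + 1)]. *)
pose N := (Num.trunc (4 * pi / lambda r1)).+1.
have q0 : 0 < 4 * pi / lambda r1 by rewrite divr_gt0// mulr_gt0.
have N1 : 4 * pi / lambda r1 < N%:R by exact: truncnS_gt.
have N2 : N%:R <= 4 * pi / lambda r1 + 1.
  by rewrite /N -natr1 lerD2r truncn_le ltW.
have NR : (0 : R) < N%:R by rewrite ltr0n.
have [u' [hu' u'01 u'1 u'0 u'u]] := hbound_add_peaks N l0 hu u01.
have lip r w : r1 <= r <= 1 -> normc w = 1 -> `|u' (r%:C * w) - u' w| <= eps.
  move=> /andP[rr1 rle1] w1.
  have r0 : 0 <= r by lra.
  rewrite (le_trans (hbound_lipschitz hu' _ w1)) ?r0// -/A'.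
  set D := (_ + _)%N.
  have DE : D%:R = (2 * l%:R + 1) * N%:R + (2 + d%:R) :> R.
    by rewrite /D !(natrD, natrM, mulrS); ring.
  have DA0 : 0 <= D%:R * A' by rewrite mulr_ge0.
  rewrite -mulrA (@le_trans _ _ ((1 - r1) * (D%:R * A')))//.
    by rewrite ler_wpM2r//; lra.
  have h1 : D%:R * A' <= K1 / lambda r1 + K2.
    have : D%:R * A' <= ((2 * l%:R + 1) * (4 * pi / lambda r1 + 1) + (2 + d%:R))
      * A'.
      by rewrite ler_wpM2r// DE lerD2r ler_wpM2l//; have := ler0n R l; lra.
    move=> /le_trans; apply; rewrite /K1 /K2 [(_ + 1) / _]mulrDl mul1r.
    have : 0 <= (lambda r1)^-1 by rewrite invr_ge0 ltW.
    set y := _^-1; lra.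
  rewrite (le_trans (ler_wpM2l (ltW s0) h1))// mulrDr.
  rewrite (_ : eps = eps / 2 + eps / 2); last by rewrite -splitr.
  apply: lerD; last first.
    rewrite -ler_pdivlMr// (le_trans r1K)// invfM mulrA//.
  have : 2 * K1 * (1 - r1) <= lambda r1 * eps.
    by move: r1l; rewrite ler_pdivlMr// mulrAC ler_pdivrMr.
  by rewrite mulrA ler_pdivrMr//; lra.
have gap : 2 * pi / N%:R <= lambda r1 - lambda r2.
  rewrite (@le_trans _ _ (lambda r1 / 2))//; last lra.
  rewrite ler_pdivrMr//; move: N1; rewrite ltr_pdivrMr// => N1; lra.
have r10 : 0 <= r1 <= r2 by rewrite r12 (le_trans rho0).
exists u', r2; split => //.
- by exists ((2 * N * l).+1 + (d + N.+1))%N, A'.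
- by split => //; apply: le_trans r12.
- move=> z zr; rewrite (le_trans (u'u _ _ (ltW rho1) zr))//.
  rewrite (_ : eps = eps / 2 + eps / 2); last by rewrite -splitr.
  apply: lerD => //; apply: n0P.
  suff nN : (n0 <= N)%N by rewrite (leq_trans nN)// leq_pmull.
  rewrite -(ler_nat R) (le_trans _ (ltW N1))// ler_pdivlMr//.
  move: r1n; rewrite ler_pdivlMr// => r1n.
  rewrite (le_trans _ r1n)// mulrC ler_wpM2l ?(ltW l10)// ler_nat leqnSn//.
move=> x; split.
(* Phase 0 gives [w ^+ N = 1], where [u'] is 1; phase [pi], in the other case, gives [w ^+ N = -1],
   where [u'] is 0. The radial estimate [lip] transfers both values inside the disc. *)
- have [r /andP[ra rb] rN] := phase_hit x 0 (isT : (0 < N)%N) r10 (ltW r21) gap.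
  exists r; first by rewrite rb (le_trans r1rho).
  have rr : r1 <= r <= 1 by rewrite ra (le_trans rb) ?ltW.
  have := lip _ _ rr (normc_expi (x + lambda r)).
  rewrite [u' (expi _)]u'1 ?normc_expi// ?rN /expi ?cos0 ?sin0//.
  by rewrite ler_norml => /andP[h _]; move: h; lra.
- have [r /andP[ra rb] rN] := phase_hit x pi (isT : (0 < N)%N) r10 (ltW r21)
    gap.
  exists r; first by rewrite rb (le_trans r1rho).
  have rr : r1 <= r <= 1 by rewrite ra (le_trans rb) ?ltW.
  have := lip _ _ rr (normc_expi (x + lambda r)).
  rewrite [u' (expi _)]u'0 ?normc_expi//; last first.
    by rewrite rN; apply/eqP; rewrite eq_complex/= cospi sinpi oppr0 !eqxx.
  by rewrite ler_norml => /andP[_ h]; move: h; lra.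
Unshelve. all: by end_near.
Qed.

End TangentialStep.

(** * Real parts of power series: smoothness and harmonicity *)

Section HarmonicSeries.
Variable R : realType.
Implicit Types (z w h : R[i]) (rho t : R) (c : nat -> R[i]) (k n : nat).
Implicit Types (f : R * R -> R) (p v : R * R).

(** Equivalent to a radius of convergence of at least 1. *)
Definition sub_exp c :=
  forall rho, 0 < rho < 1 -> exists C, forall k, normc (c k) * rho ^+ k <= C.

(** Complex coefficients are allowed because differentiating along the imaginary axis multiplies
    them by ['i]. *)
Definition hseries c z : R := limn (series (fun k => Re (c k * z ^+ k))).

(* Coefficients of h * F', the derivative of F in the direction h. *)
Definition dcoef h c k : R[i] := h * (k.+1%:R%:C * c k.+1).

(** Each of the [k.+1] powers [t ^+ i] with [i <= k] is at least [t ^+ k], and their sum is at most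
    that of the full geometric series. *)
Lemma mulSn_exp_le k t : 0 <= t < 1 -> k.+1%:R * t ^+ k <= (1 - t)^-1.
Proof.
move=> /andP[t0 t1]; have s0 : 0 < 1 - t by rewrite subr_gt0.
rewrite -[leRHS]mul1r ler_pdivlMr// mulrC.
rewrite (@le_trans _ _ ((1 - t) * \sum_(i < k.+1) t ^+ i))//.
  rewrite ler_wpM2l ?(ltW s0)// mulr_natl -[in leLHS](card_ord k.+1)
    -sumr_const.
  by apply: ler_sum => i _; rewrite ler_wiXn2l ?(ltW t1)// -ltnS.
by rewrite -[1 - t]opprB mulNr -subrX1 opprB gerBl exprn_ge0.
Qed.

(** At a radius [s] between [rho] and 1 the terms are still bounded, and [(rho / s) ^+ k] absorbs
    the factor [k]. *)
Lemma sub_exp_natmul c : sub_exp c -> sub_exp (fun k => k%:R%:C * c k).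
Proof.
move=> hc rho /andP[r0 r1]; pose s := (1 + rho) / 2.
have [s0 s1 rs] : [/\ 0 < s, s < 1 & rho < s] by rewrite /s; split; lra.
have [|C hC] := hc s; first by rewrite s0.
have rs01 : 0 <= rho / s < 1.
  by rewrite divr_ge0 ?(ltW r0) ?(ltW s0)//= ltr_pdivrMr ?mul1r.
exists ((1 - rho / s)^-1 * C) => k.
rewrite normcM normc_real normr_nat.
have -> : rho ^+ k = (rho / s) ^+ k * s ^+ k by rewrite -exprMn divfK ?gt_eqF.
rewrite mulrACA ler_pM ?mulr_ge0 ?normc_ge0 ?exprn_ge0 ?(ltW s0)//.
  by case/andP: rs01.
rewrite (le_trans _ (mulSn_exp_le k rs01))// ler_wpM2r ?ler_nat//.
by rewrite exprn_ge0//; case/andP: rs01.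
Qed.

Lemma sub_exp_dcoef h c : sub_exp c -> sub_exp (dcoef h c).
Proof.
move=> /sub_exp_natmul hc rho r01; have [C hC] := hc _ r01.
have [r0 _] := andP r01.
exists (normc h * (C / rho)) => k; rewrite normcM -mulrA ler_wpM2l ?normc_ge0//.
by rewrite ler_pdivlMr// -mulrA -exprSr.
Qed.

Lemma sub_exp_geometric c rho : sub_exp c -> 0 < rho < 1 ->
  exists C, exists2 t, 0 <= C /\ 0 <= t < 1 &
    forall k, normc (c k) * rho ^+ k <= C * t ^+ k.
Proof.
move=> hc /andP[r0 r1]; pose s := (1 + rho) / 2.
have [s0 s1 rs] : [/\ 0 < s, s < 1 & rho < s] by rewrite /s; split; lra.
have [|C hC] := hc s; first by rewrite s0.
have rs01 : 0 <= rho / s < 1.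
  by rewrite divr_ge0 ?(ltW r0) ?(ltW s0)//= ltr_pdivrMr ?mul1r.
exists C, (rho / s) => [|k].
  by split => //; rewrite (le_trans _ (hC 0%N))// mulr_ge0 ?normc_ge0.
have -> : rho ^+ k = s ^+ k * (rho / s) ^+ k by rewrite -exprMn mulrC divfK
  ?gt_eqF.
by rewrite mulrA ler_wpM2r// exprn_ge0//; case/andP: rs01.
Qed.

Lemma sub_exp_sum c rho : sub_exp c -> 0 < rho < 1 ->
  exists2 B, 0 <= B & forall n, \sum_(k < n) normc (c k) * rho ^+ k <= B.
Proof.
move=> /sub_exp_geometric/[apply] -[C [t [C0 /andP[t0 t1]] hC]].
have s0 : 0 < 1 - t by rewrite subr_gt0.
exists (C / (1 - t)) => [|n]; first by rewrite divr_ge0// ltW.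
rewrite (@le_trans _ _ (\sum_(k < n) C * t ^+ k))//; first exact: ler_sum.
rewrite -mulr_sumr ler_wpM2l// -[leRHS]mul1r ler_pdivlMr// mulrC.
by rewrite -[1 - t]opprB mulNr -subrX1 opprB gerBl exprn_ge0.
Qed.

Lemma hterm_le c z rho k : normc z <= rho ->
  `|Re (c k * z ^+ k)| <= normc (c k) * rho ^+ k.
Proof.
move=> zr; rewrite (le_trans (Re_le_normc _))// normcM normcX.
by rewrite ler_wpM2l ?normc_ge0// lerXn2r ?nnegrE ?(le_trans _ zr) ?normc_ge0.
Qed.

Lemma is_cvg_hseries c z : sub_exp c -> normc z < 1 ->
  cvgn (series (fun k => Re (c k * z ^+ k))).
Proof.
move=> hc z1; pose rho := (1 + normc z) / 2.
have [r0 r1 zr] : [/\ 0 < rho, rho < 1 & normc z < rho].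
  by have := normc_ge0 z; rewrite /rho; split; lra.
have [|C [t [C0 t01] hC]] := sub_exp_geometric hc (rho := rho).
  by rewrite r0.
have [t0 t1] := andP t01.
apply: normed_cvg; apply: (series_le_cvg (v_ := geometric C t)) => [n|n|n|].
- exact: normr_ge0.
- by rewrite mulr_ge0// exprn_ge0.
- by rewrite (le_trans (hterm_le _ _ (ltW zr))).
- by apply: is_cvg_geometric_series; rewrite ger0_norm.
Qed.

Lemma limit_norm_le (u : nat -> R) (l B : R) :
  u @ \oo --> l -> (forall n, `|u n| <= B) -> `|l| <= B.
Proof.
move=> ul uB; have nul : (fun n => `|u n|) @ \oo --> `|l| by exact: cvg_norm.
rewrite -(cvg_lim _ nul)//; apply: limr_le; first by apply/cvg_ex; exists `|l|.
by near=> n.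
Unshelve. all: by end_near. Qed.

Lemma hseries_le c z rho B : sub_exp c -> normc z <= rho -> rho < 1 ->
  (forall n, \sum_(k < n) normc (c k) * rho ^+ k <= B) -> `|hseries c z| <= B.
Proof.
move=> hc zr r1 hB; apply: limit_norm_le.
  by apply: is_cvg_hseries => //; rewrite (le_lt_trans zr).
move=> n; rewrite /series/= big_mkord (le_trans (ler_norm_sum _ _ _))//.
by rewrite (le_trans _ (hB n))//; apply: ler_sum => k _; exact: hterm_le.
Qed.

Lemma hseriesZ c z h t : sub_exp c -> normc z < 1 ->
  hseries (dcoef (t%:C * h) c) z = t * hseries (dcoef h c) z.
Proof.
move=> hc z1; pose G k := Re (dcoef h c k * z ^+ k).
rewrite /hseries (_ : (fun k => _) = t *: G).
  exact: lim_seriesZ (is_cvg_hseries (sub_exp_dcoef h hc) z1).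
by apply/funext => k; rewrite -[RHS]/(t * G k) /G /dcoef -!mulrA ReZ.
Qed.

(** Induction on [k]: the next remainder is [z + h] times the current one plus [k h^2 z^(k-1)], and
    [k^2 + k <= (k + 1)^2]. The factor [rho ^+ 2] on the left avoids the exponent [k - 2]. *)
Lemma exprD_remainder z h rho k : 0 <= rho -> normc z + normc h <= rho ->
  normc ((z + h) ^+ k - z ^+ k - k%:R%:C * (h * z ^+ k.-1)) * rho ^+ 2 <=
    k%:R ^+ 2 * rho ^+ k * normc h ^+ 2.
Proof.
move=> r0 zhr; have z0 := normc_ge0 z; have h0 := normc_ge0 h.
have zr : normc z <= rho by lra.
elim: k => [|k IH]; first by rewrite !expr0 subrr rmorph0 mul0r subr0 normc0
  mul0r !mulr_ge0 ?exprn_ge0.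
have -> : (z + h) ^+ k.+1 - z ^+ k.+1 - k.+1%:R%:C * (h * z ^+ k.+1.-1) =
    (z + h) * ((z + h) ^+ k - z ^+ k - k%:R%:C * (h * z ^+ k.-1)) +
    k%:R%:C * h ^+ 2 * z ^+ k.-1.
  rewrite -natr1 rmorphD/= !exprS; case: k {IH} => [|k] /=.
    by rewrite !expr0 -[0%:C]/(0 : R[i]) -[1%:C]/(1 : R[i]); ring.
  by rewrite !exprS; ring.
rewrite (le_trans (ler_wpM2r _ (normcD_le _ _))) ?exprn_ge0// mulrDl.
have e1 : normc ((z + h) * ((z + h) ^+ k - z ^+ k - k%:R%:C * (h * z ^+ k.-1)))
  *
    rho ^+ 2 <= rho * (k%:R ^+ 2 * rho ^+ k * normc h ^+ 2).
  rewrite normcM -mulrA ler_pM ?mulr_ge0 ?normc_ge0 ?exprn_ge0//.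
  by rewrite (le_trans (normcD_le _ _)).
have e2 : normc (k%:R%:C * h ^+ 2 * z ^+ k.-1) * rho ^+ 2 <=
    k%:R * rho ^+ k.+1 * normc h ^+ 2.
  rewrite !normcM !normcX normc_real normr_nat.
  case: k {IH e1} => [|k]; first by rewrite !mul0r.
  have zk : normc z ^+ k * rho ^+ 2 <= rho ^+ k.+2.
    by rewrite -[k.+2]addn2 exprD ler_wpM2r ?exprn_ge0// lerXn2r ?nnegrE.
  rewrite -mulrA [leRHS]mulrAC; apply: ler_pM zk => //.
    by rewrite !mulr_ge0.
  by rewrite mulr_ge0 ?exprn_ge0.
rewrite (le_trans (lerD e1 e2))// -subr_ge0.
have -> : k.+1%:R ^+ 2 * rho ^+ k.+1 * normc h ^+ 2 -
    (rho * (k%:R ^+ 2 * rho ^+ k * normc h ^+ 2) + k%:R * rho ^+ k.+1 * normc h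
      ^+ 2) =
    (k%:R + 1) * rho ^+ k.+1 * normc h ^+ 2.
  by rewrite -natr1 !exprS; ring.
by rewrite !mulr_ge0 ?exprn_ge0.
Qed.

(** Summing [exprD_remainder] over the terms gives [K = B / rho ^+ 2], where [B] bounds the partial
    sums of [k^2 |c k| rho^k]. *)
Lemma hseries_taylor c rho : sub_exp c -> 0 < rho < 1 ->
  exists2 K, 0 <= K & forall z h, normc z + normc h <= rho ->
    `|hseries c (z + h) - hseries c z - hseries (dcoef h c) z|
      <= K * normc h ^+ 2.
Proof.
move=> hc r01; have [r0 r1] := andP r01.
have [B B0 hB] := sub_exp_sum (sub_exp_natmul (sub_exp_natmul hc)) r01.
exists (B / rho ^+ 2) => [|z h zhr]; first by rewrite divr_ge0// exprn_ge0//
  ltW.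
have z0 := normc_ge0 z; have h0 := normc_ge0 h.
have z1 : normc z < 1 by lra.
have zh1 : normc (z + h) < 1 by rewrite (le_lt_trans (normcD_le _ _))
  ?(le_lt_trans zhr).
have s1 := is_cvg_hseries hc zh1; have s2 := is_cvg_hseries hc z1.
have s3 := is_cvg_hseries (sub_exp_dcoef h hc) z1.
have /cvg_ex[l1 L1] := s1; have /cvg_ex[l2 L2] := s2; have /cvg_ex[l3 L3] := s3.
rewrite /hseries (cvg_lim _ L1)// (cvg_lim _ L2)// (cvg_lim _ L3)//.
(* The derived series is one index behind: its [n]-th partial sum matches the [n.+1]-st partial sums
   of the other two, the term [k = 0] having zero derivative. *)
rewrite -cvg_shiftS in L1; rewrite -cvg_shiftS in L2.
apply: (limit_norm_le (cvgB (cvgB L1 L2) L3)) => n.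
rewrite -[X in `|X|]/(series (fun k => Re (c k * (z + h) ^+ k)) n.+1 -
  series (fun k => Re (c k * z ^+ k)) n.+1 -
  series (fun k => Re (dcoef h c k * z ^+ k)) n).
rewrite /series/= !big_mkord -sumrB [X in _ - X](_ : _ =
    \sum_(k < n.+1) Re (c k * (k%:R%:C * (h * z ^+ k.-1)))); last first.
  rewrite big_ord_recl/= mul0r !mulr0 add0r; apply: eq_bigr => k _.
  by congr Re; rewrite /dcoef /bump/=; ring.
rewrite -sumrB (le_trans (ler_norm_sum _ _ _))//.
have h20 : 0 <= normc h ^+ 2 by rewrite exprn_ge0.
have r20 : 0 <= (rho ^+ 2)^-1 by rewrite invr_ge0 exprn_ge0// ltW.
rewrite [leRHS]mulrAC (le_trans _ (ler_wpM2r r20 (ler_wpM2r h20 (hB n.+1))))//.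
rewrite !mulr_suml; apply: ler_sum => k _.
rewrite -!ReB -!mulrBr (le_trans (Re_le_normc _))// normcM.
rewrite ler_pdivlMr ?exprn_gt0// -!mulrA.
have := exprD_remainder k (ltW r0) zhr.
rewrite !normcM normc_real normr_nat.
move=> /(ler_wpM2l (normc_ge0 (c k))) /le_trans; apply.
by rewrite le_eqVlt; apply/orP; left; apply/eqP; ring.
Qed.

Lemma hseries_continuous c z rho : sub_exp c -> normc z < rho -> rho < 1 ->
  exists K, forall h, normc z + normc h <= rho ->
    `|hseries c (z + h) - hseries c z| <= K * normc h.
Proof.
move=> hc zr r1; have z0 := normc_ge0 z.
have r01 : 0 < rho < 1 by apply/andP; split; lra.
have [K K0 hK] := hseries_taylor hc r01.
have [B B0 hB] := sub_exp_sum (sub_exp_dcoef 1 hc) r01.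
exists (K + B) => h zh; have h0 := normc_ge0 h.
have E : `|hseries (dcoef h c) z| <= normc h * B.
  apply: (hseries_le (sub_exp_dcoef h hc) (ltW zr) r1) => n.
  rewrite (le_trans _ (ler_wpM2l h0 (hB n)))// mulr_sumr; apply: ler_sum => k _.
  by rewrite /dcoef mul1r normcM mulrA.
rewrite -(subrK (hseries (dcoef h c) z) (_ - hseries c z)).
rewrite (le_trans (ler_normD _ _))// mulrDl lerD//; last by rewrite mulrC.
rewrite (le_trans (hK _ _ zh))// ler_wpM2l// expr2 ler_piMr//; lra.
Qed.

Definition plane_disc : set (R * R) := [set p | normc (p.1 +i* p.2) < 1].

(** The norm on [R * R] is the maximum norm, and the modulus is at most the sum of the absolute
    coordinates. *)
Lemma normc_le_plane p : normc (p.1 +i* p.2) <= 2 * `|p|.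
Proof.
have -> : p.1 +i* p.2 = p.1%:C + 'i * p.2%:C.
  by apply/eqP; rewrite eq_complex; apply/andP; split; apply/eqP => /=; ring.
rewrite (le_trans (normcD_le _ _))// normcM !normc_real.
rewrite (_ : normc 'i = 1); last by rewrite /= expr0n expr1n add0r sqrtr1.
rewrite mul1r mulr_natl mulr2n.
by apply: lerD; rewrite /Num.norm/= le_max lexx ?orbT.
Qed.

Lemma hseries_plane_continuous c f p : sub_exp c ->
  (forall q, plane_disc q -> f q = hseries c (q.1 +i* q.2)) ->
  plane_disc p -> {for p, continuous f}.
Proof.
move=> hc fE pD; pose z := p.1 +i* p.2.
have z1 : normc z < 1 := pD.
have [rho zr r1] : exists2 rho, normc z < rho & rho < 1.
  by exists ((1 + normc z) / 2); lra.
have [K hK] := hseries_continuous hc zr r1.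
apply/cvgrPdist_le => e e0.
have d0 : 0 < (rho - normc z) / 2 by rewrite divr_gt0// subr_gt0.
have d1 : 0 < e / (2 * (`|K| + 1)) by rewrite divr_gt0// mulr_gt0// ltr_wpDl.
near=> q.
have qE : q.1 +i* q.2 = z + ((q - p).1 +i* (q - p).2).
  by apply/eqP; rewrite eq_complex; apply/andP; split; apply/eqP => /=; ring.
have nq := normc_le_plane (q - p).
have n1 : `|q - p| <= (rho - normc z) / 2.
  by rewrite distrC; near: q; apply: cvgr_dist_le.
have n2 : `|q - p| <= e / (2 * (`|K| + 1)).
  by rewrite distrC; near: q; apply: cvgr_dist_le.
set h := (q - p).1 +i* (q - p).2 in qE nq.
have zh : normc z + normc h <= rho by lra.
rewrite !fE//; last first.
  by rewrite /plane_disc /mkset qE (le_lt_trans (normcD_le _ _)) ?(le_lt_trans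
    zh).
rewrite distrC qE (le_trans (hK _ zh))//.
have := ler_norm K; have := normc_ge0 h; have K1 := normr_ge0 K.
move: n2; rewrite ler_pdivlMr ?mulr_gt0 ?ltr_wpDl// => n2 h0 KK.
have : K * normc h <= (`|K| + 1) * normc h by rewrite ler_wpM2r//; lra.
have : (`|K| + 1) * normc h <= (`|K| + 1) * (2 * `|q - p|).
  by rewrite ler_wpM2l//; lra.
lra.
Unshelve. all: by end_near. Qed.

(** For the increment [t w] with [t] real, [hseriesZ] extracts [t] from the linear term, and the
    Taylor remainder divided by [t] is at most [K |t| |w|^2]. *)
Lemma hseries_plane_derive c f p v : sub_exp c ->
  (forall q, plane_disc q -> f q = hseries c (q.1 +i* q.2)) ->
  plane_disc p -> is_derive p v f (hseries (dcoef (v.1 +i* v.2) c) (p.1 +i*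
    p.2)).
Proof.
move=> hc fE pD; pose z := p.1 +i* p.2.
pose w := v.1 +i* v.2; have z0 := normc_ge0 z; have w0 := normc_ge0 w.
have z1 : normc z < 1 := pD.
have [rho zr r1] : exists2 rho, normc z < rho & rho < 1.
  by exists ((1 + normc z) / 2); lra.
have r01 : 0 < rho < 1 by apply/andP; split; lra.
have [K K0 hK] := hseries_taylor hc r01.
suff L : h^-1 *: ((f \o shift p) (h *: v) - f p) @[h --> 0^'] -->
    (hseries (dcoef w c) z : R).
  by apply: DeriveDef; [apply/cvg_ex; eexists; exact: L | exact: cvg_lim L].
apply/cvgrPdist_le => e e0.
have d0 : 0 < (rho - normc z) / (normc w + 1).
  by rewrite divr_gt0 ?subr_gt0// ltr_wpDl.
have d1 : 0 < e / (K * normc w ^+ 2 + 1).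
  by rewrite divr_gt0// ltr_wpDl// mulr_ge0// sqr_ge0.
near=> t.
have t0 : t != 0 by near: t; exact: nbhs_dnbhs_neq.
have n1 : `|t| <= (rho - normc z) / (normc w + 1).
  by near: t; apply: dnbhs0_le.
have n2 : `|t| <= e / (K * normc w ^+ 2 + 1).
  by near: t; apply: dnbhs0_le.
have wt : normc (t%:C * w) = `|t| * normc w by rewrite normcM normc_real.
have zh : normc z + normc (t%:C * w) <= rho.
  rewrite wt; move: n1; rewrite ler_pdivlMr ?ltr_wpDl//.
  have := normr_ge0 t; lra.
have qE : (t *: v + p).1 +i* (t *: v + p).2 = z + t%:C * w.
  apply/eqP; rewrite eq_complex; apply/andP; split; apply/eqP => /=;
    rewrite /GRing.scale/=; ring.
rewrite /= !fE//; last first.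
  by rewrite /plane_disc /mkset qE (le_lt_trans (normcD_le _ _)) ?(le_lt_trans
    zh).
rewrite qE -/z; have := hK _ _ zh; rewrite hseriesZ//.
set a := hseries _ _; set b := hseries _ _; set L := hseries _ _ => le.
have -> : L - t^-1 *: (a - b) = - (t^-1 * (a - b - t * L)).
  by rewrite /GRing.scale/=; field.
rewrite normrN normrM normfV ler_pdivrMl ?normr_gt0// (le_trans le)//.
rewrite wt exprMn -[`|t| ^+ 2]/(`|t| * `|t|) mulrCA mulrA -!mulrA.
rewrite ler_wpM2l//; move: n2; rewrite ler_pdivlMr; last first.
  by rewrite ltr_wpDl// mulr_ge0// sqr_ge0.
have := normr_ge0 t; nra.
Unshelve. all: by end_near. Qed.

(** Agreement of [f] with the series is asked only on the disc, since this is all that is known of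
    [dx f] and [dy f] when the induction reaches them. *)
Lemma hseries_Ck k c f : sub_exp c ->
  (forall q, plane_disc q -> f q = hseries c (q.1 +i* q.2)) ->
  Ck_on k plane_disc f.
Proof.
elim: k c f => [|k IH] c f hc fE /=.
  by split => // p; exact: hseries_plane_continuous fE.
have D v p : plane_disc p -> _ := fun pD => hseries_plane_derive v hc fE pD.
split; first by move=> p; exact: hseries_plane_continuous fE.
split.
- by move=> p /(D (1, 0))[].
- by move=> p /(D (0, 1))[].
- apply: (IH _ _ (sub_exp_dcoef _ hc)) => p /(D (1, 0))[_ e]; exact: e.
- apply: (IH _ _ (sub_exp_dcoef _ hc)) => p /(D (0, 1))[_ e]; exact: e.
Qed.

(** Differentiating twice along the imaginary axis multiplies by ['i ^ 2 = -1] what differentiating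
    twice along the real axis gives. *)
Lemma hseries_laplacian c f p : sub_exp c ->
  (forall q, plane_disc q -> f q = hseries c (q.1 +i* q.2)) ->
  plane_disc p -> laplacian f p = 0.
Proof.
move=> hc fE pD.
have D v q : plane_disc q ->
    'D_v f q = hseries (dcoef (v.1 +i* v.2) c) (q.1 +i* q.2).
  by move=> qD; have [_] := hseries_plane_derive v hc fE qD.
have D2 v : 'D_v (fun q => 'D_v f q) p =
    hseries (dcoef (v.1 +i* v.2) (dcoef (v.1 +i* v.2) c)) (p.1 +i* p.2).
  by have [_] := hseries_plane_derive v (sub_exp_dcoef _ hc) (D v) pD.
rewrite /laplacian /dx /dy !D2 /=.
set d := dcoef 'i%C _.
have -> : d = (fun k => (-1)%:C * dcoef (1 +i* 0) (dcoef (1 +i* 0) c) k).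
  apply/funext => k; rewrite /d /dcoef.
  have -> : (-1)%:C = 'i%C * 'i%C :> R[i] by rewrite -expr2 sqr_i rmorphN1.
  rewrite -[1 +i* 0]/(1 : R[i]); ring.
have h2 := sub_exp_dcoef (1 +i* 0) (sub_exp_dcoef (1 +i* 0) hc).
pose G k := Re (dcoef (1 +i* 0) (dcoef (1 +i* 0) c) k * (p.1 +i* p.2) ^+ k).
rewrite /hseries [X in _ + limn (series X)](_ : _ = - G).
  by rewrite (lim_seriesN (is_cvg_hseries h2 pD)) subrr.
by apply/funext => k; rewrite -[RHS]/(- G k) -mulrA ReZ mulN1r.
Qed.

End HarmonicSeries.

(** * Upper and lower limits, and the harmonic limit of the approximations *)

Section TangentialLimit.
Variable R : realType.
Implicit Types (z w : R[i]) (n m k K : nat) (r rho : R).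

(** Padding with zeros gives coefficients valid at every larger degree, so polynomials of different
    degrees can be compared coefficient by coefficient. *)
Lemma hpoly_support d (a : nat -> R) : exists b : nat -> R,
  forall m, (d <= m)%N -> hpoly d a =1 hpoly m b.
Proof.
exists (fun k => if (k < d)%N then a k else 0) => m dm z.
rewrite /hpoly (big_ord_widen _ (fun k => a k * Re (z ^+ k)) dm) big_mkcond.
by apply: eq_bigr => i _; case: ifP; rewrite ?mul0r.
Qed.

Lemma hbound_le1 d A (u : R[i] -> R) : hbound d A u ->
  (forall w, normc w = 1 -> 0 <= u w <= 1) ->
  forall z, normc z <= 1 -> 0 <= u z <= 1.
Proof.
move=> hu u01 z z1; apply/andP; split.
  by apply: (hbound_ge0 hu) z1 => w /u01 /andP[].
have h1 : hbound d.+1 (1 + `|-1| * A) (fun z => Re (z ^+ 0) + -1 * u z).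
  apply: hboundD; first exact: hbound_weaken (hbound_exp _ _).
  by apply: hboundZ; apply: hbound_weaken hu.
have := hbound_ge0 h1 _ z1; rewrite expr0 mulN1r subr_ge0; apply=> w /u01
  /andP[_].
by rewrite expr0 mulN1r subr_ge0.
Qed.

Lemma cvg_geometric_steps (v : nat -> R) (C t : R) : 0 <= C -> 0 <= t < 1 ->
  (forall n, `|v n.+1 - v n| <= C * t ^+ n) -> cvgn v.
Proof.
move=> C0 /andP[t0 t1] hv; rewrite (_ : v = (fun n => v 0%N + series (telescope
  v) n)).
  apply: is_cvgD; first exact: is_cvg_cst.
  apply: normed_cvg; apply: (series_le_cvg (v_ := geometric C t)) => [n|n|n|].
  - exact: normr_ge0.
  - by rewrite mulr_ge0// exprn_ge0.
  - exact: hv.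
  - by apply: is_cvg_geometric_series; rewrite ger0_norm.
by apply/funext => n; rewrite -eq_sum_telescope.
Qed.

Lemma hpoly_tail_le (b : nat -> R) (B : R) z K m :
  (forall k, `|b k| <= B) -> normc z < 1 ->
  `|hpoly (K + m) b z - hpoly K b z| <= B * normc z ^+ K / (1 - normc z).
Proof.
move=> bB z1; have z0 := normc_ge0 z; have s0 : 0 < 1 - normc z by rewrite
  subr_gt0.
have B0 : 0 <= B by rewrite (le_trans _ (bB 0%N)).
rewrite /hpoly big_split_ord/= addrAC subrr add0r.
rewrite (le_trans (ler_norm_sum _ _ _))//.
rewrite (@le_trans _ _ (B * normc z ^+ K * \sum_(i < m) normc z ^+ i))//.
  rewrite mulr_sumr; apply: ler_sum => i _.
  rewrite normrM -mulrA ler_pM// -exprD.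
  by rewrite (le_trans (Re_le_normc _))// normcX.
rewrite ler_wpM2l ?mulr_ge0 ?exprn_ge0// -[leRHS]mul1r ler_pdivlMr// mulrC.
by rewrite -[1 - normc z]opprB mulNr -subrX1 opprB gerBl exprn_ge0.
Qed.

Lemma hseries_tail_le (b : nat -> R) (B : R) z K :
  sub_exp (fun k => (b k)%:C) -> (forall k, `|b k| <= B) -> normc z < 1 ->
  `|hseries (fun k => (b k)%:C) z - hpoly K b z|
    <= B * normc z ^+ K / (1 - normc z).
Proof.
move=> sb bB z1; have /cvg_ex[l L] := is_cvg_hseries sb z1.
rewrite /hseries (cvg_lim _ L)//.
rewrite -(cvg_shiftn K) in L.
apply: (limit_norm_le (cvgB L (cvg_cst (hpoly K b z)))) => n.
rewrite -[X in `|X|]/(series (fun k => Re ((b k)%:C * z ^+ k)) (n + K)%N - hpoly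
  K b z).
rewrite (_ : series _ _ = hpoly (K + n) b z); first exact: hpoly_tail_le.
by rewrite /series/= big_mkord addnC; apply: eq_bigr => k _; rewrite ReZ.
Qed.

Lemma limf_esup_left (f : R -> R) (l : R) :
  (forall r, 0 < r < 1 -> f r <= l) ->
  (forall (d e : R), d < 1 -> 0 < e -> exists2 r, d < r < 1 & l - e <= f r) ->
  limf_esup (fun r => (f r)%:E) 1^'- = l%:E.
Proof.
move=> fl freq; apply/eqP; rewrite eq_le; apply/andP; split.
  apply: (@le_trans _ _ (ereal_sup [set (f r)%:E | r in [set r | 0 < r < 1]])).
    apply: ereal_inf_lbound; exists [set r : R | 0 < r < 1] => //.
    near=> r; apply/andP; split.
      by near: r; exact: nbhs_left_gt.
    by near: r; exact: nbhs_left_lt.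
  by apply: ge_ereal_sup => _ [r r01 <-]; rewrite lee_fin fl.
apply: le_ereal_inf_tmp => _ [V V1 <-].
have [/= d d0 dV] := V1.
apply/lee_subgt0Pr => e e0.
have [|r /andP[dr r1] fr] := freq (1 - d) e _ e0; first by rewrite gtrBl.
apply: (@le_trans _ _ (f r)%:E); first by rewrite -EFinB lee_fin.
apply: ereal_sup_ubound; exists r => //; apply: dV => //=.
by rewrite ger0_norm ?subr_ge0 ?ltW//; lra.
Unshelve. all: by end_near. Qed.

Lemma limf_einf_left (f : R -> R) (l : R) :
  (forall r, 0 < r < 1 -> l <= f r) ->
  (forall (d e : R), d < 1 -> 0 < e -> exists2 r, d < r < 1 & f r <= l + e) ->
  limf_einf (fun r => (f r)%:E) 1^'- = l%:E.
Proof.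
move=> fl freq.
rewrite -[LHS]/(- limf_esup (fun r => (- f r)%:E) 1^'-)%E.
rewrite (@limf_esup_left _ (- l)) ?EFinN ?oppeK// => [r r01|d e d1 e0].
  by rewrite lerN2 fl.
by have [r dr fr] := freq d e d1 e0; exists r => //; rewrite -opprD lerN2.
Qed.

Section Limit.
Variables (u : nat -> R[i] -> R) (rho : nat -> R).
Hypothesis u_hbound : forall n, exists d, exists A, hbound d A (u n).
Hypothesis u_circle : forall n w, normc w = 1 -> 0 <= u n w <= 1.
Hypothesis rho_bounds : forall n, 2^-1 <= rho n < 1.
Hypothesis rho_incr : forall n, rho n <= rho n.+1.
Hypothesis rho_cvg : forall n, 1 - 2^-1 ^+ n <= rho n.+1.
Hypothesis u_close : forall n z, normc z <= rho n ->
  `|u n.+1 z - u n z| <= 2^-1 ^+ n.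

Lemma approx_disc n z : normc z <= 1 -> 0 <= u n z <= 1.
Proof. by have [d [A h]] := u_hbound n; exact: (hbound_le1 h (@u_circle n)).
  Qed.

Lemma radius_le n m : (n <= m)%N -> rho n <= rho m.
Proof.
move=> nm; rewrite -(subnK nm); elim: (m - n)%N => [|k IH]; first by rewrite
  add0n.
by rewrite addSn (le_trans IH).
Qed.

Lemma exp_half_le (e : R) : 0 < e -> exists n0, forall n, (n0 <= n)%N -> 2^-1 ^+
  n <= e.
Proof.
move=> e0; have h1 : `|2^-1 : R| < 1 by rewrite ger0_norm//; lra.
have [n0 _ H] := cvgr_le (0 : R) (cvg_expr h1) _ e0.
by exists n0 => n /H.
Qed.

Lemma radius_eventually_ge r : r < 1 -> exists n0, forall n, (n0 <= n)%N -> r <=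
  rho n.
Proof.
rewrite -subr_gt0 => /exp_half_le[n0 H].
exists n0.+1 => n /radius_le; apply: le_trans.
by rewrite (le_trans _ (rho_cvg n0))//; have := H _ (leqnn _); lra.
Qed.

Lemma approx_cauchy n m z : (n <= m)%N -> normc z <= rho n ->
  `|u m z - u n z| <= 2 * 2^-1 ^+ n.
Proof.
(* The bound is sharpened to the finite geometric sum, for which the induction on [m] closes. *)
move=> nm zn; rewrite (@le_trans _ _ (2 * 2^-1 ^+ n - 2 * 2^-1 ^+ m))//; last
  first.
  by rewrite gerBl mulr_ge0// exprn_ge0.
elim: m nm => [|m IH]; first by rewrite leqn0 => /eqP ->; rewrite !subrr normr0.
rewrite leq_eqVlt => /orP[/eqP ->|]; first by rewrite !subrr normr0.
rewrite ltnS => nm; rewrite -(subrK (u m z) (u m.+1 z)) -addrA.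
rewrite (le_trans (ler_normD _ _))//.
have := IH nm; have := u_close (le_trans zn (radius_le nm)).
rewrite exprS mulrA mulfV// mul1r; lra.
Qed.

(** The coefficients of [u n] converge one by one, and their uniform bound 2 makes the tails of all
    the series small together; so the series of the limit coefficients is the limit of the [u n]. *)
Lemma harmonic_limit : exists2 a : nat -> R, sub_exp (fun k => (a k)%:C) &
  forall n z, normc z <= rho n ->
    `|hseries (fun k => (a k)%:C) z - u n z| <= 2 * 2^-1 ^+ n.
Proof.
have /choice[b bP] n : exists b : nat -> R, exists d,
    forall m, (d <= m)%N -> u n =1 hpoly m b.
  have [d [A [a ua _]]] := u_hbound n.
  have [b hb] := hpoly_support d a; exists b, d => m dm z.
  by rewrite ua; exact: hb.
have b2 n k : `|b n k| <= 2.
  have [d hd] := bP n; pose m := maxn d k.+1.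
  have km : (k < m)%N by rewrite leq_max leqnn orbT.
  have := @hpoly_coef_le _ _ (b n) 1 1 _ km.
  rewrite expr1n !mulr1; apply => // z z1.
  rewrite -(hd m (leq_maxl _ _)) ler_norml.
  by have /andP[? ?] := u_circle n z1; apply/andP; split; lra.
(* The circle of radius 1/2 lies in every disc [normc z <= rho n]. The price is the factor [2 ^+ k],
   harmless for fixed [k]. *)
have bstep n k : `|b n.+1 k - b n k| <= (2 * 2 ^+ k) * 2^-1 ^+ n.
  have [d hd] := bP n; have [d' hd'] := bP n.+1.
  pose m := maxn (maxn d d') k.+1.
  have km : (k < m)%N by rewrite leq_max leqnn orbT.
  have := @hpoly_coef_le _ _ (fun k => b n.+1 k - b n k) 2^-1 (2^-1 ^+ n) _ km.
  rewrite -ler_pdivlMr ?exprn_gt0// -exprVn invrK mulrAC; apply => // z zh.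
  rewrite (_ : hpoly _ _ _ = u n.+1 z - u n z).
    by apply: u_close; rewrite zh; have /andP[] := rho_bounds n.
  rewrite (hd m) ?(hd' m) ?leq_max ?leqnn ?orbT// /hpoly -sumrB.
  by apply: eq_bigr => i _; rewrite mulrBl.
have bcvg k : cvgn (fun n => b n k).
  apply: (@cvg_geometric_steps _ (2 * 2 ^+ k) 2^-1) => [||n]; last exact: bstep.
    by rewrite mulr_ge0// exprn_ge0.
  by apply/andP; split; lra.
pose a k := limn (fun n => b n k).
have a2 k : `|a k| <= 2 by apply: limit_norm_le (bcvg k) _ => n; exact: b2.
have sa : sub_exp (fun k => (a k)%:C).
  move=> r /andP[r0 r1]; exists 2 => k.
  rewrite normc_real -[leRHS]mulr1 ler_pM ?exprn_ge0 ?exprn_ile1//; exact: ltW.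
exists a => // n z zn; apply/ler_addgt0Pr => e e0.
have z1 : normc z < 1 by rewrite (le_lt_trans zn)//; have /andP[] := rho_bounds
  n.
have s0 : 0 < 1 - normc z by rewrite subr_gt0.
(* The error [e] splits into [e / 4] for the tail of the limit, [e / 4] for the tail of [u m], and
   [e / 2] for the first [K] coefficients. *)
have [K hK] : exists K, 2 * normc z ^+ K / (1 - normc z) <= e / 4.
  have zz : `|normc z| < 1 by rewrite ger0_norm ?normc_ge0.
  have e'0 : 0 < e / 4 * (1 - normc z) / 2 by rewrite !divr_gt0// mulr_gt0//
    divr_gt0.
  have [K _ H] := cvgr_le (0 : R) (cvg_expr zz) _ e'0.
  exists K; rewrite ler_pdivrMr// mulrC -ler_pdivlMr//.
  exact: (H K (leqnn K)).
have polcvg : (fun m => hpoly K (b m) z) @ \oo --> hpoly K a z.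
  rewrite /hpoly; elim: K {hK} => [|K IH].
    by under eq_fun do rewrite big_ord0; rewrite big_ord0; exact: cvg_cst.
  under eq_fun do rewrite big_ord_recr; rewrite big_ord_recr.
  by apply: cvgD => //; apply: cvgM; [exact: bcvg | exact: cvg_cst].
have e20 : 0 < e / 2 by rewrite divr_gt0.
have /cvgrPdist_le/(_ _ e20)[m0 _ hm0] := polcvg.
pose m := maxn n m0.
have h1 := hseries_tail_le K sa a2 z1.
have [d hd] := bP m.
have h2 := hpoly_tail_le K d (b2 m) z1.
rewrite -(hd _ (leq_addl _ _)) in h2.
have h3 : `|hpoly K a z - hpoly K (b m) z| <= e / 2 := hm0 m (leq_maxr _ _).
have h4 := approx_cauchy (leq_maxl n m0) zn.
move: h1 h2 h3 h4; rewrite -/m !ler_norml.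
move=> /andP[? ?] /andP[? ?] /andP[? ?] /andP[? ?].
by apply/andP; split; lra.
Qed.

End Limit.

End TangentialLimit.

(** * Iteration of the step, and behaviour of the limit along the curves *)

Lemma tangential_sequence (R : realType) (lambda : R -> R) :
  {within `[0, 1], continuous lambda} -> lambda 1 = 0 ->
  lambda r / (1 - r) @[r --> 1^'-] --> +oo ->
  exists (u : nat -> R[i] -> R) (rho : nat -> R),
  [/\ forall n, exists d, exists A, hbound d A (u n),
      forall n w, normc w = 1 -> 0 <= u n w <= 1,
      forall n, [/\ 2^-1 <= rho n < 1, rho n <= rho n.+1 &
        1 - 2^-1 ^+ n <= rho n.+1],
      forall n z, normc z <= rho n -> `|u n.+1 z - u n z| <= 2^-1 ^+ n &
      forall n x,
        (exists2 r, rho n <= r <= rho n.+1 &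
          1 - 2^-1 ^+ n <= u n.+1 (r%:C * expi (x + lambda r))) /\
        (exists2 r, rho n <= r <= rho n.+1 &
          u n.+1 (r%:C * expi (x + lambda r)) <= 2^-1 ^+ n)].
Proof.
move=> lambda_cont lambda1 lambda_lim.
(* The invariant is packed with the state, so that choice yields a total step function; the index is
   passed along to set the tolerance [2^-1 ^+ n]. *)
pose good (s : (R[i] -> R) * R) := [/\ exists d, exists A, hbound d A s.1,
  forall w, normc w = 1 -> 0 <= s.1 w <= 1 & 2^-1 <= s.2 < 1].
pose next (n : nat) (s s' : (R[i] -> R) * R) := [/\ s.2 <= s'.2,
  1 - 2^-1 ^+ n <= s'.2,
  forall z, normc z <= s.2 -> `|s'.1 z - s.1 z| <= 2^-1 ^+ n &
  forall x,
    (exists2 r, s.2 <= r <= s'.2 &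
      1 - 2^-1 ^+ n <= s'.1 (r%:C * expi (x + lambda r))) /\
    (exists2 r, s.2 <= r <= s'.2 &
      s'.1 (r%:C * expi (x + lambda r)) <= 2^-1 ^+ n)].
have /choice[step stepP] (a : nat * {s | good s}) :
    exists s' : {s | good s}, next a.1 (sval a.2) (sval s').
  case: a => n [[u rho] [[d [A hu]] u01 /andP[/= rho0 rho1]]] /=.
  have rho01 : 0 <= rho < 1 by apply/andP; split; lra.
  have e0 : (0 : R) < 2^-1 ^+ n by rewrite exprn_gt0.
  have [u' [rho' [hu' u'01 [r1 r2 r3] uu' hit]]] :=
    tangential_step lambda_cont lambda1 lambda_lim hu u01 rho01 e0.
  have g : good (u', rho') by split => //; rewrite /= r2 (le_trans rho0).
  by exists (exist _ _ g).
(* Starting at radius 1/2 keeps every [rho n] at least 1/2, as the coefficient estimate in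
   [harmonic_limit] requires. *)
have g0 : good (fun=> 0, 2^-1).
  split => /=; last by apply/andP; split; lra.
    exists 0%N, 0, (fun=> 0); first by move=> z; rewrite /hpoly big_ord0.
    by rewrite big_ord0.
  by move=> w _; rewrite lexx ler01.
pose fix S n := if n is n'.+1 then step (n', S n') else exist good _ g0.
have SP n : next n (sval (S n)) (sval (S n.+1)) := stepP (n, S n).
have SG n : good (sval (S n)) := svalP (S n).
exists (fun n => (sval (S n)).1), (fun n => (sval (S n)).2).
split=> n.
- by have [] := SG n.
- by have [] := SG n.
- by have [? ? ?] := SG n; have [? ? ? ?] := SP n.
- by have [] := SP n.
- by have [] := SP n.
Qed.

Theorem corollary1p2 (R : realType) (lambda : R -> R)
    (lambda_cont : {within `[0, 1], continuous lambda})
    (lambda1 : lambda 1 = 0)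
    (lambda_lim : lambda r / (1 - r) @[r --> 1^'-] --> +oo) :
  exists u : R[i] -> R,
    [/\ harmonic_on (unit_disc R) u,
        forall z : R[i], unit_disc R z -> 0 <= u z <= 1 &
        forall x : R,
          limf_esup (fun r : R => (u (r%:C * expi (x + lambda r)))%:E) 1^'-
            = 1%:E /\
          limf_einf (fun r : R => (u (r%:C * expi (x + lambda r)))%:E) 1^'-
            = 0%:E].
Proof.
have [u [rho [hu u01 rhoP uu hit]]] :=
  tangential_sequence lambda_cont lambda1 lambda_lim.
have rho1 n : 2^-1 <= rho n < 1 by have [] := rhoP n.
have rhoI n : rho n <= rho n.+1 by have [] := rhoP n.
have rhoC n : 1 - 2^-1 ^+ n <= rho n.+1 by have [] := rhoP n.
have [a sa Ua] := harmonic_limit hu u01 rho1 rhoI uu.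
set U := hseries _ in Ua.
have late (r e : R) : r < 1 -> 0 < e ->
    exists n, [/\ r <= rho n, r <= rho n.+1 & 2^-1 ^+ n <= e].
  move=> r1 e0; have [n1 H1] := radius_eventually_ge rhoI rhoC r1.
  have [n2 H2] := exp_half_le e0; exists (maxn n1 n2).
  by split; rewrite ?H1 ?H2 ?leq_maxr ?leq_maxl// leqW ?leq_maxl.
have U01 z : normc z < 1 -> 0 <= U z <= 1.
  move=> z1; have ud n := approx_disc hu u01 n (ltW z1).
  apply/andP; split; apply/ler_addgt0Pr => e e0;
    have e20 : 0 < e / 2 by [rewrite divr_gt0];
    have [n [zn _ ne]] := late _ _ z1 e20;
    have := Ua _ _ zn; rewrite ler_norml => /andP[? ?];
    by have /andP[? ?] := ud n; lra.
have normE r x : 0 <= r -> normc (r%:C * expi (x + lambda r)) = r.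
  by move=> r0; rewrite normcM normc_expi normc_real mulr1 ger0_norm.
(* Closeness at stage [n.+1] gives [2 * 2^-1 ^+ n.+1], which is the tolerance of stage [n]. *)
have UE n r x : rho n <= r <= rho n.+1 ->
    `|U (r%:C * expi (x + lambda r)) - u n.+1 (r%:C * expi (x + lambda r))|
      <= 2^-1 ^+ n.
  move=> /andP[r1 r2]; have /andP[? ?] := rho1 n; have r0 : 0 <= r by lra.
  rewrite (le_trans (Ua n.+1 _ _)) ?normE//.
  by rewrite exprS mulrA mulfV ?mul1r.
exists U; split.
- have discE : [set p : R * R | unit_disc R (p.1 +i* p.2)] = @plane_disc R.
    by apply/funext => p; rewrite /unit_disc /plane_disc /mkset normc_lt1E.
  rewrite /harmonic_on discE; split.
    exact: (hseries_Ck _ sa).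
  by move=> p; exact: (hseries_laplacian sa).
- by move=> z; rewrite /unit_disc/mkset normc_lt1E; exact: U01.
move=> x; split.
- apply: limf_esup_left => [r /andP[r0 r1]|d e d1 e0].
    by have /andP[] := U01 _ (eq_ind_r (fun y => y < 1) r1 (normE r x (ltW
      r0))).
  (* The midpoint of [d] and 1 makes [d < r] strict. Half of [e] covers the tolerance in [hit], the
     other half the passage from [u n.+1] to [U]. *)
  have d2 : (1 + d) / 2 < 1 by lra.
  have e20 : 0 < e / 2 by rewrite divr_gt0.
  have [n [dn _ ne]] := late _ _ d2 e20.
  have [[r rr ur] _] := hit n x.
  have := UE n r x rr; rewrite ler_norml => /andP[? ?].
  have /andP[? ?] := rr; have /andP[? ?] := rho1 n.+1.
  by exists r; [apply/andP; split; lra | lra].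
- apply: limf_einf_left => [r /andP[r0 r1]|d e d1 e0].
    by have /andP[] := U01 _ (eq_ind_r (fun y => y < 1) r1 (normE r x (ltW
      r0))).
  have d2 : (1 + d) / 2 < 1 by lra.
  have e20 : 0 < e / 2 by rewrite divr_gt0.
  have [n [dn _ ne]] := late _ _ d2 e20.
  have [_ [r rr ur]] := hit n x.
  have := UE n r x rr; rewrite ler_norml => /andP[? ?].
  have /andP[? ?] := rr; have /andP[? ?] := rho1 n.+1.
  by exists r; [apply/andP; split; lra | lra].
Qed.
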